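(* Let $\mathbb{K}$ be $\mathbb{R}$ or $\mathbb{C}$, let $(X,\|\cdot\|)$ be a nonzero Banach space over $\mathbb{K}$, let $p\ge 1$ be an integer and $a_1,\ldots,a_p\in\mathbb{K}$. Suppose that the characteristic equation $r^p=a_1r^{p-1}+a_2r^{p-2}+\cdots+a_p$ has $p$ distinct complex roots $r_1,\ldots,r_p$, and that $|r_k|>1$ for $1\le k\le p$. Then the best Ulam constant of the difference equation $x_{n+p}=a_1x_{n+p-1}+\cdots+a_px_n$, $n\in\mathbb{N}$, in $X$ is $$K_R=\frac{1}{|V|}\sum_{s=1}^{\infty}\left|\frac{V_1}{r_1^s}-\frac{V_2}{r_2^s}+\cdots+\frac{(-1)^{p+1}V_p}{r_p^s}\right|,$$ where $V=V(r_1,\ldots,r_p)$ and $V_k=V(r_1,\ldots,r_{k-1},r_{k+1},\ldots,r_p)$, $1\le k\le p$, are Vandermonde determinants. That is, this number $K_R$ is an Ulam constant of the equation, and it is the infimum of all Ulam constants of the equation.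
   Context: $\mathbb{N}=\{0,1,2,\ldots\}$. A real number $K\ge 0$ is called an Ulam constant of the equation $x_{n+p}=a_1x_{n+p-1}+\cdots+a_px_n$ ($n\in\mathbb{N}$) in $X$ if for every $\varepsilon>0$ and every sequence $(x_n)_{n\ge 0}$ in $X$ satisfying $\|x_{n+p}-a_1x_{n+p-1}-\cdots-a_px_n\|\le\varepsilon$ for all $n\in\mathbb{N}$, there exists a sequence $(y_n)_{n\ge 0}$ in $X$ with $y_{n+p}=a_1y_{n+p-1}+\cdots+a_py_n$ and $\|x_n-y_n\|\le K\varepsilon$ for all $n\in\mathbb{N}$. If the infimum of all Ulam constants of the equation is itself an Ulam constant, it is called the best Ulam constant of the equation. The Vandermonde determinant of complex numbers $t_1,\ldots,t_m$ is $V(t_1,\ldots,t_m)=\det\big(t_j^{\,i-1}\big)_{1\le i,j\le m}=\prod_{1\le i<j\le m}(t_j-t_i)$, with the value $1$ when $m=0$ or $m=1$. The list in $V_k$ is $(r_1,\ldots,r_p)$ with $r_k$ omitted and the order of the other entries preserved. When $\mathbb{K}=\mathbb{R}$ the coefficients $a_i$ are real but the roots $r_k$ may be non-real complex numbers. *)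

(* Defs.v *)
From HB Require Import structures.
From mathcomp Require Export all_boot all_order all_algebra.
From mathcomp Require Export all_classical all_reals all_analysis.
From mathcomp Require Export complex.

Set Implicit Arguments.
Unset Strict Implicit.
Unset Printing Implicit Defensive.

Import Order.TTheory GRing.Theory Num.Theory.
Import numFieldNormedType.Exports.

Local Open Scope classical_set_scope.
Local Open Scope ring_scope.

(* The coefficients a_1, ..., a_p are indexed from 0: a_(i+1) is [a i]. *)

Definition rec_rhs (K : numFieldType) (X : lmodType K) (p : nat)
    (a : 'I_p -> K) (x : nat -> X) (n : nat) : X :=
  \sum_(i < p) a i *: x (n + (p - i.+1))%N.

Definition is_char_root (K : numFieldType) (p : nat) (a : 'I_p -> K) (z : K) :
    Prop :=
  z ^+ p = \sum_(i < p) a i * z ^+ (p - i.+1).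

(* The norm of a [normedModType K] takes its values in [K], so that the real
   bounds have to be injected into [K]; [emb] is the canonical embedding of R
   into K, i.e. the identity when K = R and [real_complex R] when K = R[i]. *)
Definition is_ulam_constant (R : realType) (K : numFieldType)
    (emb : {rmorphism R -> K}) (X : normedModType K) (p : nat)
    (a : 'I_p -> K) (L : R) : Prop :=
  0 <= L /\
  forall eps : R, 0 < eps ->
  forall x : nat -> X,
    (forall n, `|x (n + p)%N - rec_rhs a x n| <= emb eps) ->
    exists y : nat -> X,
      (forall n, y (n + p)%N = rec_rhs a y n) /\
      (forall n, `|x n - y n| <= emb (L * eps)).

Definition is_best_ulam_constant (R : realType) (K : numFieldType)
    (emb : {rmorphism R -> K}) (X : normedModType K) (p : nat)
    (a : 'I_p -> K) (L : R) : Prop :=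
  is_ulam_constant emb X a L /\
  L = inf [set M : R | is_ulam_constant emb X a M].

(* The real-valued modulus; [`|z|] is the same number seen in R[i]. *)
Definition modulus (R : realType) (z : R[i]) : R := ComplexField.Normc.normc z.

Definition vdm (R : realType) (m : nat) (t : 'rV[R[i]]_m) : R[i] :=
  \det (Vandermonde m t).

Definition vdm_omit (R : realType) (p : nat) (r : 'I_p -> R[i]) (k : 'I_p) :
    R[i] :=
  vdm (col' k (\row_j r j)).

(* With k counted from 0, the sign (-1)^(k+1) of the k-th root, k >= 1,
   becomes (-1)^k. *)
Definition KR_term (R : realType) (p : nat) (r : 'I_p -> R[i]) (s : nat) : R :=
  modulus (\sum_(k < p) (-1) ^+ k * vdm_omit r k / r k ^+ s).

Definition KR (R : realType) (p : nat) (r : 'I_p -> R[i]) : R :=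
  (modulus (vdm (\row_j r j)))^-1 *
  limn (fun n => \sum_(1 <= s < n) KR_term r s).

(* Main.v *)
(* The sequence H_j = sum_k d_k r_k^(p-1-j), with d_k = (-1)^(p-1+k) V_k / V (k
   counted from 0), is the Green function of the equation: H_0 = 1, H_j = 0 for
   0 < j < p, and H_j = sum_i a_(i+1) H_(j+i+1).  As |r_k| > 1 it is summable,
   so that S b n = sum_s H_(p+s) b_(n+s) makes sense for bounded b, and
   S b (n+p) - sum_i a_(i+1) S b (n+p-i-1) = - b n.
   Since sum_s |H_(p+s)| = K_R, adding to an approximate solution x the sequence
   S b, with b the residual of x, gives an exact solution within K_R eps.
   Conversely, for b_s = (|H_(p+s)| / H_(p+s)) u with |u| = 1, the sequence S b
   is an approximate solution for eps = 1 whose value at 0 has norm K_R, and an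
   exact solution at finite distance from it is bounded, hence 0 because S
   inverts the difference operator on bounded sequences. *)

Require Import Defs.
From mathcomp Require Import all_boot all_order all_algebra.
From mathcomp Require Import all_classical all_reals all_analysis.
From mathcomp Require Import complex.

Set Implicit Arguments.
Unset Strict Implicit.
Unset Printing Implicit Defensive.

Import Order.TTheory GRing.Theory Num.Theory.
Import numFieldNormedType.Exports.

Local Open Scope classical_set_scope.
Local Open Scope ring_scope.

(** * Limits in normed spaces, and the passage from real bounds to [K]-valued ones *)

Lemma cvg_bigsum (K : numFieldType) (X : normedModType K) (I : Type)
    (s : seq I) (u : I -> nat -> X) (l : I -> X) :
  (forall i, u i n @[n --> \oo] --> l i) ->
  \sum_(i <- s) u i n @[n --> \oo] --> \sum_(i <- s) l i.
Proof. by move=> ul; apply: cvg_big => //; exact: add_continuous. Qed.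

Lemma cvgn_norm_le (K : numFieldType) (X : normedModType K) (u : nat -> X)
    (l : X) (B : K) :
  u n @[n --> \oo] --> l -> (forall n, `|u n| <= B) -> `|l| <= B.
Proof.
move=> ul uB; apply/ler_addgt0Pr => e e0.
have /cvgrPdist_lt/(_ e e0)[N _ /(_ N (leqnn N))/= lN] := ul.
rewrite -(subrK (u N) l) (le_trans (ler_normD _ _))// addrC lerD//.
exact: ltW.
Qed.

Lemma emb_norm (R : realType) (K : numFieldType) (emb : {rmorphism R -> K})
    (emb_mono : {mono emb : x y / x <= y}) (x : R) : `|emb x| = emb `|x|.
Proof.
have [x0|x0] := lerP 0 x.
  by rewrite (ger0_norm x0) ger0_norm// -(rmorph0 emb) emb_mono.
by rewrite (ltr0_norm x0) ler0_norm ?rmorphN// -(rmorph0 emb) emb_mono ltW.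
Qed.

(** [emb_surj] turns a tolerance in [K] into a real one; it is available over [R[i]] too, where a
    positive element is real. *)
Lemma emb_cvg (R : realType) (K : numFieldType) (emb : {rmorphism R -> K})
    (emb_mono : {mono emb : x y / x <= y})
    (emb_surj : forall e, 0 < e -> exists e', emb e' = e)
    (u : nat -> R) (l : R) :
  u n @[n --> \oo] --> l -> emb (u n) @[n --> \oo] --> emb l.
Proof.
move=> ul; apply/cvgrPdist_lt => _/posnumP[e].
have [e' ee'] := emb_surj e%:num (gt0 e).
have e'0 : 0 < e' by rewrite -(leW_mono emb_mono) rmorph0 ee'.
have /cvgrPdist_lt/(_ e' e'0) := ul; apply: filterS => n.
by rewrite -rmorphB emb_norm// -ee' (leW_mono emb_mono).
Qed.

(** * Vector series with absolutely summable scalar weights *)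

Lemma cvgn_series_scale (R : realType) (K : numFieldType)
    (emb : {rmorphism R -> K}) (emb_mono : {mono emb : x y / x <= y})
    (emb_surj : forall e, 0 < e -> exists e', emb e' = e)
    (X : completeNormedModType K) (w : nat -> K) (c : nat -> R)
    (b : nat -> X) (B : K) :
  (forall s, `|w s| = emb (c s)) -> cvgn (series c) ->
  (forall s, `|b s| <= B) ->
  cvgn (series (fun s => w s *: b s)).
Proof.
move=> wc /cauchy_cvgP/cauchy_seriesP cc bB.
apply/cauchy_cvgP/cauchy_seriesP => e e0.
have B0 : 0 <= B by apply: le_trans (bB 0%N).
(* The bound [B] may be 0, so the tolerance is divided by [B + 1]. *)
have B1 : 0 < B + 1 by rewrite ltr_wpDl.
have [e' ee'] := emb_surj (e / (B + 1)) (divr_gt0 e0 B1).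
have e'0 : 0 < e' by rewrite -(leW_mono emb_mono) rmorph0 ee' divr_gt0.
have c0 s : 0 <= c s by rewrite -emb_mono rmorph0 -wc.
apply: filterS (cc _ e'0) => -[m n] /=.
rewrite ger0_norm ?sumr_ge0// -(leW_mono emb_mono) ee' ltr_pdivlMr//.
apply: le_lt_trans; apply: (le_trans (ler_norm_sum _ _ _)).
rewrite rmorph_sum mulr_suml ler_sum// => s _.
rewrite normrZ wc ler_wpM2l ?(le_trans (bB _)) ?lerDl//.
by rewrite -wc.
Qed.

Lemma series_scale_norm_le (R : realType) (K : numFieldType)
    (emb : {rmorphism R -> K}) (emb_mono : {mono emb : x y / x <= y})
    (X : normedModType K) (w : nat -> K) (c : nat -> R) (L : R)
    (b : nat -> X) (B : K) (l : X) :
  (forall s, `|w s| = emb (c s)) -> series c n @[n --> \oo] --> L ->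
  (forall s, `|b s| <= B) ->
  series (fun s => w s *: b s) n @[n --> \oo] --> l ->
  `|l| <= emb L * B.
Proof.
move=> wc cL bB bl; apply: (cvgn_norm_le bl) => n.
have B0 : 0 <= B by apply: le_trans (bB 0%N).
have c0 s : 0 <= c s by rewrite -emb_mono rmorph0 -wc.
rewrite (le_trans (ler_norm_sum _ _ _))//.
apply: (@le_trans _ _ (emb (series c n) * B)).
  rewrite rmorph_sum mulr_suml ler_sum// => s _.
  by rewrite normrZ wc ler_wpM2l// -wc.
rewrite ler_wpM2r// emb_mono -(cvg_lim (@Rhausdorff R) cL).
apply: nondecreasing_cvgn_le; last by apply/cvg_ex; exists L.
by apply: nondecreasing_series => s _ _.
Qed.

Lemma series_shift (V : zmodType) (u : nat -> V) (k m : nat) :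
  series u (m + k)%N =
    \sum_(0 <= j < k) u j + series (fun s => u (k + s)%N) m.
Proof.
rewrite /series/= (big_cat_nat (leq0n k) (leq_addl m k))/=; congr (_ + _).
rewrite -{1}[k]add0n big_addn addnK.
by apply: eq_bigr => s _; rewrite addnC.
Qed.

(** * Inversion of the difference operator by an abstract Green function *)

(** The series of [H j *: b (n + j)] is summed in two ways: splitting off its first [p] terms gives
    [b n + S (n + p)], and expanding each [H j] by the recurrence gives [rec_rhs a S n]. *)
Lemma green_residual (K : numFieldType) (X : normedModType K) (p : nat)
    (a : 'I_p -> K) (H : nat -> K) (b S : nat -> X) :
  (0 < p)%N -> H 0%N = 1 -> (forall j, (0 < j < p)%N -> H j = 0) ->
  (forall j, H j = \sum_(i < p) a i * H (j + i.+1)%N) ->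
  (forall n,
    series (fun s => H (p + s)%N *: b (n + s)%N) m @[m --> \oo] --> S n) ->
  forall n, S (n + p)%N = rec_rhs a S n - b n.
Proof.
move=> p0 H0 Hz Hrec bS n.
have limH : series (fun j => H j *: b (n + j)%N) m @[m --> \oo] -->
    b n + S (n + p)%N.
  rewrite -(cvg_shiftn p)/=; under eq_fun do rewrite series_shift.
  apply: cvgD; last first.
    rewrite (_ : (fun s => H (p + s)%N *: b (n + (p + s))%N) =
      fun s => H (p + s)%N *: b (n + p + s)%N); first exact: bS.
    by apply/funext => s; rewrite addnA.
  rewrite big_ltn// big_nat big1 ?addr0 ?addn0 ?H0 ?scale1r; last first.
    by move=> j jp; rewrite Hz ?scale0r.
  exact: cvg_cst.
have limHi (i : 'I_p) : series (fun j => H (j + i.+1)%N *: b (n + j)%N) m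
    @[m --> \oo] --> S (n + (p - i.+1))%N.
  (* The [p - i.+1] terms split off vanish, since there [0 < j + i.+1 < p]. *)
  rewrite -(cvg_shiftn (p - i.+1))/=; under eq_fun do rewrite series_shift.
  rewrite big_nat big1 => [|j /andP[_ jp]]; last first.
    by rewrite Hz ?scale0r// addnS/= -addnS addnC -ltn_subRL.
  under eq_fun do rewrite add0r.
  rewrite (_ : (fun s => H (p - i.+1 + s + i.+1)%N *: b (n + (p - i.+1 + s))%N) =
    fun s => H (p + s)%N *: b (n + (p - i.+1) + s)%N); first exact: bS.
  by apply/funext => s; rewrite addnAC subnK// addnA.
have limS : series (fun j => H j *: b (n + j)%N) m @[m --> \oo] -->
    rec_rhs a S n.
  have E : series (fun j => H j *: b (n + j)%N) = fun m =>
      \sum_(i < p) a i *: series (fun j => H (j + i.+1)%N *: b (n + j)%N) m.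
    apply/funext => m; under [RHS]eq_bigr do rewrite scaler_sumr.
    rewrite exchange_big; apply: eq_bigr => j _.
    rewrite {1}Hrec scaler_suml.
    by apply: eq_bigr => i _; rewrite scalerA.
  rewrite E; apply: cvg_bigsum => i; apply: cvgZl_tmp.
  exact: limHi.
have -> : rec_rhs a S n = b n + S (n + p)%N.
  exact: (cvg_unique (@norm_hausdorff K X) limS limH).
by rewrite addrC addKr.
Qed.

Lemma rec_rhsB (K : numFieldType) (X : lmodType K) (p : nat) (a : 'I_p -> K)
    (x y : nat -> X) (n : nat) :
  rec_rhs a (fun m => x m - y m) n = rec_rhs a x n - rec_rhs a y n.
Proof.
by rewrite /rec_rhs -sumrB; apply: eq_bigr => i _; rewrite scalerBr.
Qed.

(** The weights do not depend on [n], so [S] commutes with shifts and hence with the difference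
    operator. *)
Lemma green_residual_swap (K : numFieldType) (X : normedModType K) (p : nat)
    (a : 'I_p -> K) (w : nat -> K) (b S : nat -> X) :
  (forall n, series (fun s => w s *: b (n + s)%N) m @[m --> \oo] --> S n) ->
  forall n, series (fun s => w s *:
      (b (n + s + p)%N - rec_rhs a b (n + s))) m @[m --> \oo] -->
    S (n + p)%N - rec_rhs a S n.
Proof.
move=> bS n.
have -> : series (fun s => w s *: (b (n + s + p)%N - rec_rhs a b (n + s))) =
    fun m => series (fun s => w s *: b (n + p + s)%N) m -
      \sum_(i < p) a i *:
        series (fun s => w s *: b (n + (p - i.+1) + s)%N) m.
  apply/funext => m; under [in RHS]eq_bigr do rewrite scaler_sumr.
  rewrite exchange_big -sumrB; apply: eq_bigr => s _.
  rewrite scalerBr [in LHS]addnAC scaler_sumr; congr (_ - _).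
  by apply: eq_bigr => i _; rewrite !scalerA mulrC addnAC.
apply: cvgB; first exact: bS.
by apply: cvg_bigsum => i; apply: cvgZl_tmp; exact: bS.
Qed.

(** The residual of [S] is [- y] by the Green identity, and 0 because [S] commutes with the
    difference operator, which kills [y]. *)
Lemma bounded_solution_eq0 (R : realType) (K : numFieldType)
    (emb : {rmorphism R -> K}) (emb_mono : {mono emb : x y / x <= y})
    (emb_surj : forall e, 0 < e -> exists e', emb e' = e)
    (X : completeNormedModType K) (p : nat) (a : 'I_p -> K) (H : nat -> K)
    (c : nat -> R) (y : nat -> X) (B : K) :
  (0 < p)%N -> H 0%N = 1 -> (forall j, (0 < j < p)%N -> H j = 0) ->
  (forall j, H j = \sum_(i < p) a i * H (j + i.+1)%N) ->
  (forall s, `|H (p + s)%N| = emb (c s)) -> cvgn (series c) ->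
  (forall n, `|y n| <= B) -> (forall n, y (n + p)%N = rec_rhs a y n) ->
  forall n, y n = 0.
Proof.
move=> p0 H0 Hz Hrec Hc cc yB yrec n.
pose S m := limn (series (fun s => H (p + s)%N *: y (m + s)%N)).
have yS m : series (fun s => H (p + s)%N *: y (m + s)%N) k @[k --> \oo] --> S m.
  by apply: (cvgn_series_scale emb_mono emb_surj Hc cc).
have := green_residual p0 H0 Hz Hrec yS n.
have := green_residual_swap (a := a) yS (n := n).
rewrite (_ : series _ = fun=> 0); last first.
  apply/funext => m; rewrite /series/= big1// => s _.
  by rewrite yrec subrr scaler0.
move=> /(cvg_unique (@norm_hausdorff K X) (cvg_cst _)) E S_eq.
move/eqP: E; rewrite S_eq addrAC subrr add0r eq_sym oppr_eq0.
by move/eqP.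
Qed.

(** * Upper and lower bounds for Ulam constants *)

Lemma green_ulam_constant (R : realType) (K : numFieldType)
    (emb : {rmorphism R -> K}) (emb_mono : {mono emb : x y / x <= y})
    (emb_surj : forall e, 0 < e -> exists e', emb e' = e)
    (X : completeNormedModType K) (p : nat) (a : 'I_p -> K) (H : nat -> K)
    (c : nat -> R) (L : R) :
  (0 < p)%N -> H 0%N = 1 -> (forall j, (0 < j < p)%N -> H j = 0) ->
  (forall j, H j = \sum_(i < p) a i * H (j + i.+1)%N) ->
  (forall s, `|H (p + s)%N| = emb (c s)) -> series c n @[n --> \oo] --> L ->
  is_ulam_constant emb X a L.
Proof.
move=> p0 H0 Hz Hrec Hc cL.
have cc : cvgn (series c) by apply/cvg_ex; exists L.
split=> [|eps eps0 x xeps].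
  rewrite -(cvg_lim (@Rhausdorff R) cL); apply: limr_ge => //.
  apply: nearW => n; apply: sumr_ge0 => s _.
  by rewrite -emb_mono rmorph0 -Hc.
pose b n := x (n + p)%N - rec_rhs a x n.
pose S n := limn (series (fun s => H (p + s)%N *: b (n + s)%N)).
have bS n : series (fun s => H (p + s)%N *: b (n + s)%N) m @[m --> \oo] --> S n.
  apply: (cvgn_series_scale emb_mono emb_surj Hc cc) => s.
  exact: xeps.
exists (fun n => x n - - S n); split=> n.
  rewrite rec_rhsB (_ : rec_rhs a (fun m => - S m) n = - rec_rhs a S n).
    rewrite (green_residual p0 H0 Hz Hrec bS n) /b.
    by rewrite !opprK opprB addrCA [x _ + _]addrC !addrA subrK addrC.
  by rewrite /rec_rhs -sumrN; apply: eq_bigr => i _; rewrite scalerN.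
rewrite opprK opprD addrA subrr add0r normrN rmorphM.
apply: (series_scale_norm_le emb_mono Hc cL _ (bS n)) => s; exact: xeps.
Qed.

Lemma green_le_ulam_constant (R : realType) (K : numFieldType)
    (emb : {rmorphism R -> K}) (emb_mono : {mono emb : x y / x <= y})
    (emb_surj : forall e, 0 < e -> exists e', emb e' = e)
    (X : completeNormedModType K) (p : nat) (a : 'I_p -> K) (H : nat -> K)
    (c : nat -> R) (L M : R) :
  (exists v : X, v != 0) ->
  (0 < p)%N -> H 0%N = 1 -> (forall j, (0 < j < p)%N -> H j = 0) ->
  (forall j, H j = \sum_(i < p) a i * H (j + i.+1)%N) ->
  (forall s, `|H (p + s)%N| = emb (c s)) -> series c n @[n --> \oo] --> L ->
  is_ulam_constant emb X a M -> L <= M.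
Proof.
move=> [v v0] p0 H0 Hz Hrec Hc cL [M0 MP].
have cc : cvgn (series c) by apply/cvg_ex; exists L.
pose u := `|v|^-1 *: v.
have u1 : `|u| = 1 by rewrite normrZV// unitfE normr_eq0.
(* Where [H] vanishes, division by zero makes the phase 0, so its modulus is only bounded by 1. *)
pose phase s := `|H (p + s)%N| / H (p + s)%N.
have phase1 s : `|phase s| <= 1.
  rewrite /phase normrM normfV normr_id.
  by have [->|h0] := eqVneq (H (p + s)%N) 0; rewrite ?normr0 ?mul0r// divff ?normr_eq0.
pose b s := phase s *: u.
have b1 s : `|b s| <= 1 by rewrite normrZ u1 mulr1.
pose S n := limn (series (fun s => H (p + s)%N *: b (n + s)%N)).
have bS n : series (fun s => H (p + s)%N *: b (n + s)%N) m @[m --> \oo] --> S n.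
  by apply: (cvgn_series_scale emb_mono emb_surj Hc cc).
have SL n : `|S n| <= emb L.
  rewrite -[emb L]mulr1.
  by apply: (series_scale_norm_le emb_mono Hc cL _ (bS n)).
have S0 : S 0%N = emb L *: u.
  apply: (cvg_unique (@norm_hausdorff K X) (bS 0%N)).
  rewrite (_ : series _ = fun m => emb (series c m) *: u).
    by apply: cvgZr_tmp; apply: (emb_cvg emb_mono emb_surj cL).
  apply/funext => m; rewrite rmorph_sum scaler_suml; apply: eq_bigr => s _.
  rewrite add0n scalerA /phase -Hc; congr (_ *: _).
  by have [->|h0] := eqVneq (H (p + s)%N) 0; rewrite ?normr0 ?mul0r// mulrC divfK.
have [|y [yrec yS]] := MP 1 ltr01 S.
  move=> n; rewrite (green_residual p0 H0 Hz Hrec bS n).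
  by rewrite addrAC subrr add0r normrN rmorph1.
have y0 : y 0%N = 0.
  (* [S] is bounded by [L] and [y] stays within [M] of it. *)
  apply: (bounded_solution_eq0 (B := emb L + emb M) emb_mono emb_surj
    p0 H0 Hz Hrec Hc cc _ yrec) => n.
  rewrite -[y n](subKr (S n)) (le_trans (ler_normB _ _))// lerD//.
  by have := yS n; rewrite mulr1.
have := yS 0%N; rewrite y0 subr0 mulr1 S0 normrZ u1 mulr1 emb_norm// emb_mono.
by apply: le_trans; rewrite ler_norm.
Qed.

Lemma green_best_ulam_constant (R : realType) (K : numFieldType)
    (emb : {rmorphism R -> K}) (emb_mono : {mono emb : x y / x <= y})
    (emb_surj : forall e, 0 < e -> exists e', emb e' = e)
    (X : completeNormedModType K) (p : nat) (a : 'I_p -> K) (H : nat -> K)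
    (c : nat -> R) (L : R) :
  (exists v : X, v != 0) ->
  (0 < p)%N -> H 0%N = 1 -> (forall j, (0 < j < p)%N -> H j = 0) ->
  (forall j, H j = \sum_(i < p) a i * H (j + i.+1)%N) ->
  (forall s, `|H (p + s)%N| = emb (c s)) -> series c n @[n --> \oo] --> L ->
  is_best_ulam_constant emb X a L.
Proof.
move=> v0 p0 H0 Hz Hrec Hc cL.
have UL := green_ulam_constant emb_mono emb_surj X p0 H0 Hz Hrec Hc cL.
have lbL : lbound [set M : R | is_ulam_constant emb X a M] L.
  move=> M.
  exact: (green_le_ulam_constant emb_mono emb_surj v0 p0 H0 Hz Hrec Hc cL).
split=> //; apply/eqP; rewrite eq_le lb_le_inf//=; last by exists L.
by apply: ge_inf => //; exists L.
Qed.

(** * The Green function built from the characteristic roots *)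

Lemma normc_modulus (R : realType) (z : R[i]) :
  `|z| = real_complex R (modulus z).
Proof. by []. Qed.

(** The power of exponent [p - 1 - j] is written as a quotient because this exponent is negative for
    [j >= p]. *)
Definition green (R : realType) (p : nat) (r : 'I_p -> R[i]) (j : nat) : R[i] :=
  \sum_(k < p) (-1) ^+ (p.-1 + k) * vdm_omit r k / vdm (\row_j r j) *
    (r k ^+ p.-1 / r k ^+ j).

Lemma vdm_neq0 (R : realType) (p : nat) (r : 'I_p -> R[i]) :
  injective r -> vdm (\row_j r j) != 0.
Proof.
move=> r_inj; rewrite /vdm det_Vandermonde.
apply/prodf_neq0 => i _; apply/prodf_neq0 => j ij.
rewrite !mxE subr_eq0; apply: contraTneq ij => /r_inj ->.
by rewrite ltnn.
Qed.

(* Laplace expansion of V along its last row, with that row replaced by the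
   [m]-th powers. *)
Lemma vdm_omit_sum (R : realType) (q : nat) (r : 'I_q.+1 -> R[i]) (m : 'I_q.+1) :
  \sum_(k < q.+1) (-1) ^+ (q + k) * vdm_omit r k * r k ^+ m =
    vdm (\row_j r j) *+ (m == ord_max).
Proof.
pose A := Vandermonde q.+1 (\row_j r j).
have /matrixP/(_ m ord_max) := mul_mx_adj A.
rewrite !mxE => <-; apply: eq_bigr => k _.
rewrite !mxE mulrC; congr (_ * (_ * \det _)).
apply/matrixP => i j; rewrite !mxE; congr (_ ^+ _).
by rewrite lift_max.
Qed.

Section GreenRoots.
Context (R : realType) (p : nat) (p_gt0 : (0 < p)%N) (r : 'I_p -> R[i]).
Context (r_inj : injective r) (r_gt1 : forall k : 'I_p, 1 < modulus (r k)).

Let r_neq0 k : r k != 0.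
Proof.
apply: contraTneq (r_gt1 k) => ->.
by rewrite /modulus ComplexField.Normc.normc0 ltr10.
Qed.

(** Here the exponent [q - j], with [q = p - 1], is a row index of the Vandermonde matrix, so the
    Laplace sum is a determinant with a repeated row unless [j = 0], when it is V itself. *)
Lemma green_small j : (j < p)%N -> green r j = (j == 0%N)%:R.
Proof.
case: p p_gt0 r r_inj r_neq0 => // q _ r' r'_inj r'_neq0 jq.
have qj : (q - j < q.+1)%N by rewrite ltnS leq_subr.
transitivity ((\sum_(k < q.+1) (-1) ^+ (q + k) * vdm_omit r' k *
    r' k ^+ (Ordinal qj)) / vdm (\row_j r' j)).
  rewrite mulr_suml; apply: eq_bigr => k _ /=.
  by rewrite -exprB ?unitfE// mulrAC.
rewrite vdm_omit_sum -val_eqE/=.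
rewrite -[X in _ == X]subn0 eqn_sub2lE//.
case: eqP => _; last by rewrite mulr0n mul0r.
by rewrite mulr1n divff// vdm_neq0.
Qed.

Lemma green_rec (a : 'I_p -> R[i]) j :
  (forall k, is_char_root a (r k)) ->
  green r j = \sum_(i < p) a i * green r (j + i.+1).
Proof.
move=> ar; under [RHS]eq_bigr do rewrite mulr_sumr.
rewrite exchange_big/=; apply: eq_bigr => k _.
under eq_bigr do rewrite mulrCA; rewrite -mulr_sumr; congr (_ * _).
(* A factor [r k ^+ p] is isolated for the characteristic equation to replace. *)
have -> : r k ^+ p.-1 / r k ^+ j = r k ^+ p * (r k ^+ p.-1 / r k ^+ (j + p)).
  by rewrite exprD invfM [RHS]mulrC -!mulrA mulVf ?mulr1// expf_neq0.
rewrite ar mulr_suml; apply: eq_bigr => i _; rewrite -mulrA; congr (_ * _).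
have -> : (j + p = j + i.+1 + (p - i.+1))%N by rewrite -addnA subnKC.
by rewrite exprD invfM [LHS]mulrC -!mulrA mulVf ?mulr1// expf_neq0.
Qed.

(** The roots may be non-real, but the recurrence has real coefficients and real initial values, and
    it can be solved for its furthest term. *)
Lemma green_real (a : 'I_p -> R) j :
  (forall k, is_char_root (fun i => real_complex R (a i)) (r k)) ->
  green r j \is Num.real.
Proof.
move=> ar; have gr := green_rec _ ar.
elim/ltn_ind: j => j IH.
have [jp|pj] := ltnP j p; first by rewrite green_small// realn.
have lt_p : (p.-1 < p)%N by rewrite ltn_predL.
pose l := Ordinal lt_p.
have lt_pS (i : 'I_p) : i != l -> (i.+1 < p)%N.
  move=> il; rewrite ltn_neqAle ltn_ord andbT; apply: contraNneq il => ip.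
  by apply/eqP/val_inj; exact: (congr1 predn ip).
have lastE m : green r m = real_complex R (a l) * green r (m + p) +
    \sum_(i < p | i != l) real_complex R (a i) * green r (m + i.+1).
  by rewrite gr (bigD1 l)//= prednK.
(* [a l] is the last coefficient; were it 0, the recurrence at [j = 0] would read 1 = 0. *)
have al0 : real_complex R (a l) != 0.
  apply/eqP => al0; have := lastE 0%N; rewrite green_small// al0 mul0r add0r.
  rewrite big1 => [/eqP|i il]; first by rewrite oner_eq0.
  by rewrite add0n green_small ?lt_pS// mulr0.
have -> : green r j = (green r (j - p) - \sum_(i < p | i != l)
    real_complex R (a i) * green r (j - p + i.+1)) / real_complex R (a l).
  by rewrite (lastE (j - p)%N) addrK subnK// mulrC mulKf.
have realC x : real_complex R x \is Num.real by apply/complex_realP; exists x.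
rewrite rpred_div// rpredB ?IH ?ltn_subrL ?p_gt0 ?(leq_trans p_gt0)//.
apply: rpred_sum => i il; rewrite rpredM// IH//.
by rewrite -[X in (_ < X)%N](subnK pj) ltn_add2l lt_pS.
Qed.

(** As [p + s = (p - 1) + (s + 1)], the numerator power cancels and leaves the inverse powers of
    exponent [s + 1]: index [s] here is term [s + 1] of K_R. *)
Lemma green_norm s : `|green r (p + s)| =
  real_complex R (KR_term r s.+1 / modulus (vdm (\row_j r j))).
Proof.
have -> : green r (p + s) = (-1) ^+ p.-1 *
    (\sum_(k < p) (-1) ^+ k * vdm_omit r k / r k ^+ s.+1) / vdm (\row_j r j).
  rewrite mulr_sumr mulr_suml; apply: eq_bigr => k _.
  have -> : (p + s = p.-1 + s.+1)%N by rewrite addnS -addSn prednK.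
  rewrite [r k ^+ (_ + _)]exprD invfM mulVKf ?expf_neq0// exprD -!mulrA.
  by congr (_ * (_ * (_ * _))); rewrite mulrC.
rewrite !normrM normrX normrN1 expr1n mul1r normfV !normc_modulus.
by rewrite rmorphM fmorphV.
Qed.

(** Comparison with a finite sum of geometric series of ratios [1 / |r_k| < 1]; the index shift puts
    one factor [q k] into [C k]. *)
Lemma KR_term_cvg : cvgn (series (fun s => KR_term r s.+1)).
Proof.
pose q k := (modulus (r k))^-1.
have q0 k : 0 < q k by rewrite invr_gt0 (lt_trans ltr01).
have q1 k : `|q k| < 1 by rewrite gtr0_norm// invf_lt1// (lt_trans ltr01).
pose C k := modulus (vdm_omit r k) * q k.
have modulus_ge0 (z : R[i]) : 0 <= modulus z.
  by rewrite -lecR -normc_modulus normr_ge0.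
apply: (@series_le_cvg _ _ (fun s => \sum_k geometric (C k) (q k) s)) => [s|s|s|].
- exact: modulus_ge0.
- apply: sumr_ge0 => k _; rewrite mulr_ge0 ?exprn_ge0 ?mulr_ge0 ?modulus_ge0//.
  exact: ltW. exact: ltW.
- rewrite -lecR -normc_modulus rmorph_sum (le_trans (ler_norm_sum _ _ _))//.
  apply: ler_sum => k _.
  rewrite !normrM normrX normrN1 expr1n mul1r normfV normrX !normc_modulus.
  rewrite -rmorphXn -fmorphV -rmorphM lecR /geometric/=.
  by rewrite exprS invfM -exprVn mulrA.
apply/cvg_ex; exists (\sum_k C k / (1 - q k)).
rewrite (_ : series _ = fun n => \sum_k series (geometric (C k) (q k)) n).
  by apply: cvg_bigsum => k; exact: cvg_geometric_series.
by apply/funext => n; rewrite /series/= exchange_big.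
Qed.
End GreenRoots.

(** * Identification of the Green sum with K_R, over real and complex scalars *)

Theorem theorem2p4 (R : realType) (p : nat) (hp : (0 < p)%N)
    (r : 'I_p -> R[i]) (hr_distinct : injective r)
    (hr_gt1 : forall k : 'I_p, 1 < modulus (r k)) :
  (* the series defining K_R converges *)
  cvgn (fun n => \sum_(1 <= s < n) KR_term r s) /\
  (* K = R *)
  (forall (a : 'I_p -> R) (X : completeNormedModType R),
     (exists v : X, v != 0) ->
     (forall k : 'I_p, is_char_root (fun i => real_complex R (a i)) (r k)) ->
     is_best_ulam_constant (idfun : {rmorphism R -> R}) X a (KR r)) /\
  (* K = C *)
  (forall (a : 'I_p -> R[i]) (X : completeNormedModType R[i]),
     (exists v : X, v != 0) ->
     (forall k : 'I_p, is_char_root a (r k)) ->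
     is_best_ulam_constant (real_complex R : {rmorphism R -> R[i]}) X a (KR r)).
Proof.
have shiftE : (fun n => \sum_(1 <= s < n.+1) KR_term r s) =
    series (fun s => KR_term r s.+1).
  by apply/funext => n; rewrite big_add1.
have cvgK : cvgn (fun n => \sum_(1 <= s < n) KR_term r s).
  have /cvg_ex[l] := KR_term_cvg hr_gt1; rewrite -shiftE => Kl.
  by apply/cvg_ex; exists l; rewrite -cvg_shiftS.
pose c s := KR_term r s.+1 / modulus (vdm (\row_j r j)).
have cK : series c n @[n --> \oo] --> KR r.
  have -> : series c = fun n => (modulus (vdm (\row_j r j)))^-1 *
      \sum_(1 <= s < n.+1) KR_term r s.
    apply/funext => n; rewrite big_add1 mulr_sumr.
    by apply: eq_bigr => s _; rewrite mulrC.
  apply: cvgMl_tmp.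
  by rewrite (cvg_shiftS (fun n => \sum_(1 <= s < n) KR_term r s)).
have green0 : green r 0 = 1 by rewrite green_small.
have greenS j : (0 < j < p)%N -> green r j = 0.
  by case/andP => j0 jp; rewrite green_small// gtn_eqF.
split; [exact: cvgK|split] => a X v0 ar.
(* Over the reals the Green function is replaced by its real part, which equals it; each property
   descends by injectivity of the embedding. *)
- pose H j := complex.Re (green r j).
  have HE j : real_complex R (H j) = green r j.
    by rewrite RRe_real// (green_real hp hr_distinct hr_gt1 j ar).
  apply: (@green_best_ulam_constant R R idfun _ _ X p a H c (KR r) v0 hp) => //.
  + by move=> e _; exists e.
  + by apply: complexI; rewrite HE green0.
  + by move=> j /greenS j0; apply: complexI; rewrite HE j0.
  + move=> j; apply: complexI; rewrite HE rmorph_sum (green_rec hr_gt1 j ar).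
    by apply: eq_bigr => i _; rewrite rmorphM /= HE.
  + move=> s; apply: complexI; rewrite -green_norm// -HE.
    by rewrite emb_norm//; exact: lecR.
- apply: (@green_best_ulam_constant R R[i] (real_complex R) _ _ X p a
    (green r) c (KR r) v0 hp) => //.
  + exact: lecR.
  + by move=> e /gtr0_real/complex_realP[e' ->]; exists e'.
  + by move=> j; exact: green_rec.
  + by move=> s; rewrite green_norm.
Qed.
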